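(* Let $C$ be a circle and let $\mathcal{D}$ be an ellipse inside $C$, concentric with $C$, such that there are triangles inscribed in $C$ and circumscribed about $\mathcal{D}$ (a Poncelet circle-ellipse concentric configuration with $n=3$). For each such triangle $P_1P_2P_3$ (a $3$-orbit), let $\theta_i$ be its internal angle at $P_i$ and let $F_i$ be the Frégier circle of $(P_i,\theta_i)$ with respect to $C$. Then the sum of areas $\operatorname{Area}(F_1)+\operatorname{Area}(F_2)+\operatorname{Area}(F_3)$ is the same for all $3$-orbits $P_1P_2P_3$ of the configuration $(C,\mathcal{D})$. Moreover, suppose $(C,\mathcal{D})$ is the image of the elliptic billiard $3$-periodic configuration in an ellipse $\mathcal{E}$ with semi-axes $a\ge b>0$ under the scaling by $b/a$ along the major axis of $\mathcal{E}$ (so $C$ is the circle of radius $b$, the image of $\mathcal{E}$, and $\mathcal{D}$ is the image of the billiard caustic). Then this constant sum equals $$\pi b^2\left(1-\frac{\rho}{2}\right),$$ where $\rho=(1-h^2)/2$ and $h\in[0,1)$ is the unique number in $[0,1)$ with $(a/b)^2=\dfrac{(1+h)(3-h)}{(1-h)(3+h)}$.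
   Context: Frégier circle: for a point $P$ on a circle $C$ and $\theta\in(0,\pi)$, $\theta\ne\pi/2$, the Frégier circle of $(P,\theta)$ is the circle, concentric with $C$, tangent to every line $NL$ where $N,L\in C\setminus\{P\}$ are distinct and the triangle $PNL$ has internal angle $\angle NPL=\theta$ at $P$; for $\theta=\pi/2$ it degenerates to the center of $C$, with area $0$. The area of a circle is the area of the disc it bounds. Elliptic billiard $3$-periodic configuration: the triangles inscribed in $\mathcal{E}$ which are closed billiard trajectories in $\mathcal{E}$ (at each vertex the two sides make equal angles with the normal to $\mathcal{E}$, i.e. specular reflection). They form a one-parameter family, all of whose members are circumscribed about one fixed ellipse confocal (hence concentric) with $\mathcal{E}$, called the caustic; the $3$-orbits are the triangles inscribed in $\mathcal{E}$ and circumscribed about this caustic. A circle counts as an ellipse. *)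

(* Defs.v *)
From HB Require Import structures.
From mathcomp Require Export all_boot all_order all_algebra.
From mathcomp Require Export all_classical all_reals all_analysis.
Export Order.TTheory GRing.Theory Num.Theory.

Set Implicit Arguments.
Unset Strict Implicit.
Unset Printing Implicit Defensive.

Local Open Scope classical_set_scope.
Local Open Scope ring_scope.

Section PlaneGeometry.
Context {R : realType}.

(* The canonical norm on R * R is the sup norm, hence a separate Euclidean one. *)
Definition dot (v w : R * R) : R := v.1 * w.1 + v.2 * w.2.
Definition enorm (v : R * R) : R := Num.sqrt (dot v v).

Definition perp (v : R * R) : R * R := (- v.2, v.1).

(* Unoriented angle, in [0, pi]. *)
Definition vangle (v w : R * R) : R := acos (dot v w / (enorm v * enorm w)).

Definition internal_angle (P N L : R * R) : R := vangle (N - P) (L - P).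

Definition is_triangle (A B D : R * R) : Prop := dot (perp (B - A)) (D - A) != 0.

Definition line (A B : R * R) : set (R * R) := [set A + t *: (B - A) | t in setT].

(* For a line and a circle or an ellipse, tangency means exactly one common
   point. *)
Definition tangent (l S : set (R * R)) : Prop := exists! X, (l `&` S) X.

Definition inscribed (S : set (R * R)) (P1 P2 P3 : R * R) : Prop :=
  [/\ S P1, S P2 & S P3].

Definition circumscribed (S : set (R * R)) (P1 P2 P3 : R * R) : Prop :=
  [/\ tangent (line P1 P2) S, tangent (line P2 P3) S & tangent (line P3 P1) S].

(* A circle of radius 0 is a point. *)
Record circle := Circle { center : R * R; radius : R }.

Definition ccurve (C : circle) : set (R * R) :=
  [set X | enorm (X - center C) = radius C].

Definition disc (C : circle) : set (R * R) :=
  [set X | enorm (X - center C) <= radius C].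

Definition area (C : circle) : \bar R :=
  (@lebesgue_measure R \x @lebesgue_measure R)%E (disc C).

(* The ellipse with unit major direction u = axis, semi-axis smaj along u and
   semi-axis smin along perp u.  Circles are the case smin = smaj. *)
Record ellipse := Ellipse {
  ecenter : R * R;
  axis : R * R;
  smaj : R;
  smin : R;
  axis_unit : enorm axis = 1;
  smin_gt0 : 0 < smin;
  smin_le_smaj : smin <= smaj }.

(* Coordinates of X in the orthonormal frame (ecenter; axis, perp axis). *)
Definition xcoord (E : ellipse) (X : R * R) : R := dot (X - ecenter E) (axis E).
Definition ycoord (E : ellipse) (X : R * R) : R :=
  dot (X - ecenter E) (perp (axis E)).

Definition ecurve (E : ellipse) : set (R * R) :=
  [set X | (xcoord E X / smaj E) ^+ 2 + (ycoord E X / smin E) ^+ 2 = 1].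

(* Outer normal at X: half the gradient of the left-hand side in ecurve. *)
Definition normal (E : ellipse) (X : R * R) : R * R :=
  (xcoord E X / smaj E ^+ 2) *: axis E
  + (ycoord E X / smin E ^+ 2) *: perp (axis E).

Definition foci (E : ellipse) : set (R * R) :=
  let f := Num.sqrt (smaj E ^+ 2 - smin E ^+ 2) *: axis E in
  [set ecenter E + f; ecenter E - f].

Definition confocal (E K : ellipse) : Prop := foci E = foci K.

Definition inside (D : ellipse) (C : circle) : Prop :=
  forall X, ecurve D X -> enorm (X - center C) < radius C.

Definition poncelet3 (C : circle) (D : ellipse) (P1 P2 P3 : R * R) : Prop :=
  [/\ is_triangle P1 P2 P3, inscribed (ccurve C) P1 P2 P3
    & circumscribed (ecurve D) P1 P2 P3].

(* The circle of radius r concentric with C is tangent to all the chords NL of C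
   seen from P under the angle theta. *)
Definition fregier_tangent (C : circle) (P : R * R) (theta r : R) : Prop :=
  forall N L, ccurve C N -> ccurve C L -> N != P -> L != P -> N != L ->
    internal_angle P N L = theta ->
    tangent (line N L) (ccurve (Circle (center C) r)).

Definition fregier_radius (C : circle) (P : R * R) (theta : R) : R :=
  if theta == pi / 2 then 0
  else get [set r | 0 < r /\ fregier_tangent C P theta r].

Definition fregier_circle (C : circle) (P : R * R) (theta : R) : circle :=
  Circle (center C) (fregier_radius C P theta).

Definition fregier_area_sum (C : circle) (P1 P2 P3 : R * R) : \bar R :=
  (area (fregier_circle C P1 (internal_angle P1 P2 P3))
   + area (fregier_circle C P2 (internal_angle P2 P3 P1))
   + area (fregier_circle C P3 (internal_angle P3 P1 P2)))%E.

(* The rays PN and PL make equal angles with the normal to E at P. *)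
Definition reflects (E : ellipse) (P N L : R * R) : Prop :=
  vangle (N - P) (normal E P) = vangle (L - P) (normal E P).

Definition billiard3 (E : ellipse) (P1 P2 P3 : R * R) : Prop :=
  [/\ is_triangle P1 P2 P3, inscribed (ecurve E) P1 P2 P3
    & [/\ reflects E P1 P2 P3, reflects E P2 P3 P1 & reflects E P3 P1 P2]].

Definition is_caustic (E K : ellipse) : Prop :=
  confocal E K /\
  forall P1 P2 P3, billiard3 E P1 P2 P3 -> circumscribed (ecurve K) P1 P2 P3.

(* The scaling by smin / smaj along the major axis of E, fixing the minor axis
   line pointwise. *)
Definition major_scaling (E : ellipse) (X : R * R) : R * R :=
  ecenter E + (smin E / smaj E * xcoord E X) *: axis E
  + ycoord E X *: perp (axis E).

Definition h_param (a b h : R) : Prop :=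
  [/\ 0 <= h, h < 1
    & (a / b) ^+ 2 = ((1 + h) * (3 - h)) / ((1 - h) * (3 + h))].

End PlaneGeometry.

Arguments circle R : clear implicits.
Arguments ellipse R : clear implicits.

(* Main.v *)
Require Import Defs.
From mathcomp Require Import ring lra.
Import numFieldNormedType.Exports.

(* By the inscribed angle theorem the Fregier circle of (P, theta) has radius
   r |cos theta|, which is the distance from the center to the opposite side of
   the triangle, so its squared radius is (r^2 + N.L) / 2.  Hence the area sum
   is determined by the sum of the three dot products of the vertices.
   In the frame of D, with semi-axes al and be, a chord of C is tangent to D iff
   its endpoints are conjugate for a diagonal bilinear form:
     (r^2 - al^2 + be^2) x x' + (r^2 + al^2 - be^2) y y'
       = r^2 (al^2 + be^2 - r^2).
   A triangle all of whose sides satisfy this forces the closing condition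
   al + be = r and fixes the sum of dot products to al^2 + be^2 - 2 r^2, so the
   area sum is pi (r^2 + al^2 + be^2) / 2.  In the billiard case, confocality
   and al + be = r already determine the caustic:
   al = b (1 + h) / 2 and be = b (1 - h) / 2. *)

Local Open Scope classical_set_scope.
Local Open Scope ring_scope.

(** * Area of a disc *)

Section Area.
Variable R : realType.
Local Notation mu := (@lebesgue_measure R).

Lemma dot_ge0 (v : R * R) : 0 <= dot v v.
Proof. by rewrite /dot -!expr2 addr_ge0 ?sqr_ge0. Qed.

Lemma enorm_sqr (v : R * R) : enorm v ^+ 2 = dot v v.
Proof. by rewrite sqr_sqrtr ?dot_ge0. Qed.

Lemma enorm_le (v : R * R) (r : R) :
  0 <= r -> (enorm v <= r) = (dot v v <= r ^+ 2).
Proof.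
by move=> r0; rewrite -enorm_sqr ler_sqr// nnegrE sqrtr_ge0.
Qed.

Lemma is_derive_continuous (F F' : R -> R) :
  (forall x : R, is_derive x 1 F (F' x)) -> continuous F.
Proof.
move=> dF x; apply/differentiable_continuous/derivable1_diffP.
by have [] := dF x.
Qed.

Lemma is_derive_oo_LRcontinuous (F F' : R -> R) a b :
  (forall x : R, is_derive x 1 F (F' x)) -> derivable_oo_LRcontinuous F a b.
Proof.
move=> dF; have cF := is_derive_continuous _ _ dF.
split => [x _| |]; first by have [] := dF x.
- exact: cvg_at_right_filter (cF a).
- exact: cvg_at_left_filter (cF b).
Qed.

(** Provides the antiderivative that evaluates the disc integral after the substitution x = c + r
    sin t. *)
Lemma is_derive_sin_cos (r t : R) :
  is_derive t 1 (fun t : R => r ^+ 2 * (t + sin t * cos t)) (2 * (r * cos t) ^+ 2).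
Proof.
apply: is_derive_eq.
rewrite /GRing.scale/=.
transitivity (r ^+ 2 * (1 + cos t ^+ 2 - sin t ^+ 2)); first by ring.
by rewrite sin2cos2; ring.
Qed.

Lemma is_derive_affine_sin (c r t : R) :
  is_derive t 1 (fun t : R => c + r * sin t) (r * cos t).
Proof. by apply: is_derive_eq; rewrite add0r mul1r. Qed.

(** Substitute x = c + r sin t for t in [-pi/2, pi/2]: there cos t >= 0, so the square root is r cos
    t and the integrand becomes 2 (r cos t)^2. *)
Lemma integral_half_disc (c r : R) : 0 < r ->
  (\int[mu]_(x in `[(c - r)%R, (c + r)%R]) (2 * Num.sqrt (r ^+ 2 - (x - c) ^+ 2))%:E
  = (pi * r ^+ 2)%:E)%E.
Proof.
move=> r0; set G := fun x => 2 * Num.sqrt (r ^+ 2 - (x - c) ^+ 2).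
set F := fun t : R => c + r * sin t.
have F'E : F^`()%classic = fun t => r * cos t.
  by apply/funext => t; rewrite derive1E; have := is_derive_affine_sin c r t => -[].
have cF : continuous F.
  exact: (is_derive_continuous _ _ (is_derive_affine_sin c r)).
have cF' : continuous (F^`()%classic).
  by rewrite F'E; apply: is_derive_continuous => t; exact: is_derive_eq.
have cG : continuous G.
  move=> x; apply: (@continuous_comp _ _ _
    (fun x => Num.sqrt (r ^+ 2 - (x - c) ^+ 2)) (fun y => 2 * y)); last first.
    by move: (Num.sqrt _); apply: is_derive_continuous => t; exact: is_derive_eq.
  apply: (@continuous_comp _ _ _ (fun x => r ^+ 2 - (x - c) ^+ 2) Num.sqrt).
    by move: x; apply: is_derive_continuous => t; exact: is_derive_eq.
  exact: sqrt_continuous.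
have pi2 : - (pi / 2) < pi / 2 :> R by have := pi_gt0 R; lra.
have -> : c - r = F (- (pi / 2)) by rewrite /F sinN sin_pihalf mulrN1.
have -> : c + r = F (pi / 2) by rewrite /F sin_pihalf mulr1.
rewrite (@integration_by_substitution_increasing _ F G); last 7 first.
- exact: ltW.
- by move=> x y xI yI xy; rewrite /F ltrD2l ltr_pM2l// ltr_sin.
- by move=> x _; exact: cF'.
- by apply: cvgP; apply: cvg_at_right_filter; exact: cF'.
- by apply: cvgP; apply: cvg_at_left_filter; exact: cF'.
- exact: (is_derive_oo_LRcontinuous _ _ _ _ (is_derive_affine_sin c r)).
- exact: continuous_subspaceT.
set H := fun t : R => r ^+ 2 * (t + sin t * cos t).
transitivity (\int[mu]_(t in `[(- (pi / 2))%R, (pi / 2)%R])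
    (2 * (r * cos t) ^+ 2)%:E)%E; last first.
  rewrite (@continuous_FTC2 _ _ H)//.
  - by rewrite -EFinB /H cosN cos_pihalf !mulr0 !addr0; congr EFin; field.
  - apply: continuous_subspaceT.
    by apply: is_derive_continuous => t; exact: is_derive_eq.
  - exact: (is_derive_oo_LRcontinuous _ _ _ _ (is_derive_sin_cos r)).
  - by move=> t _; rewrite derive1E; have := is_derive_sin_cos r t => -[].
apply: eq_integral => t; rewrite inE/= in_itv/= => tI.
rewrite /GRing.mul/= F'E; congr EFin.
have c0 : 0 <= r * cos t by rewrite mulr_ge0 ?(ltW r0)// cos_ge0_pihalf.
rewrite /G /F addrAC subrr add0r.
have -> : r ^+ 2 - (r * sin t) ^+ 2 = (r * cos t) ^+ 2.
  by rewrite !exprMn sin2cos2; ring.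
by rewrite sqrtr_sqr ger0_norm// -mulrA -expr2.
Qed.

(** The product measure integrates the lengths of vertical sections, which are intervals over
    [c.1 - r, c.1 + r] and empty elsewhere. Radius 0 is included for the degenerate Fregier circles
    at right angles. *)
Lemma area_circle (c : R * R) (r : R) : 0 <= r ->
  area (Circle c r) = (pi * r ^+ 2)%:E.
Proof.
move=> r0; rewrite /area /product_measure1.
pose f x : \bar R := (2 * Num.sqrt (r ^+ 2 - (x - c.1) ^+ 2))%:E.
transitivity (\int[mu]_(x in `[(c.1 - r)%R, (c.1 + r)%R]) f x)%E; last first.
  move: r0; rewrite le_eqVlt => /predU1P[<-|]; last exact: integral_half_disc.
  by rewrite subr0 addr0 set_itv1 integral_set1 expr0n mulr0.
rewrite [RHS]integral_mkcond; apply: eq_integral => x _ /=.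
rewrite patchE mem_setE in_itv/=.
have itvE : (c.1 - r <= x <= c.1 + r) = (0 <= r ^+ 2 - (x - c.1) ^+ 2).
  by rewrite -ler_distl -ler_sqr ?nnegrE// real_normK ?num_real// subr_ge0.
rewrite itvE; case: ifPn => [s0|].
  set s := Num.sqrt (r ^+ 2 - (x - c.1) ^+ 2).
  have -> : xsection (disc (Circle c r)) x = [set` `[c.2 - s, c.2 + s]].
    have yE y : (c.2 - s <= y <= c.2 + s) = ((y - c.2) ^+ 2 <= s ^+ 2).
      by rewrite -ler_distl -ler_sqr ?nnegrE ?sqrtr_ge0// real_normK ?num_real.
    apply/seteqP; split => y; rewrite /xsection/= inE /disc/= enorm_le// in_itv/=
      yE sqr_sqrtr// /dot/= -!expr2; lra.
  rewrite lebesgue_measure_itv/= lte_fin.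
  have : 0 <= s by exact: sqrtr_ge0.
  (* The interval length formula tests a strict inequality of endpoints, so a section reduced to a
     point is treated apart. *)
  rewrite le_eqVlt => /predU1P[s00|s1].
    by rewrite -s00 subr0 addr0 ltxx /f -/s -s00 mulr0.
  rewrite ifT; last by lra.
  by rewrite /f -/s -EFinB; congr EFin; ring.
rewrite -ltNge => s0.
rewrite (_ : xsection _ _ = set0) ?measure0//.
apply/seteqP; split => y //; rewrite /xsection/= inE /disc/= enorm_le//.
rewrite /dot/= -!expr2 => h; have := sqr_ge0 (y - c.2); lra.
Qed.
End Area.

(** * Triangles self-conjugate for a diagonal form *)

Section Conjugate.
Variable R : realType.
Implicit Types x y m k r al be : R.

(** The last hypothesis is the tangency criterion of [tangent_oval]. Multiplied by r2 - P1.P2, which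
    is half the squared chord length and hence nonzero, the conjugacy relation becomes r2 times that
    criterion. *)
Lemma circle_chord_conjugate r2 al be x1 y1 x2 y2 :
  x1 ^+ 2 + y1 ^+ 2 = r2 -> x2 ^+ 2 + y2 ^+ 2 = r2 ->
  (x1, y1) != (x2, y2) ->
  (x1 * y2 - y1 * x2) ^+ 2 =
    al ^+ 2 * (y2 - y1) ^+ 2 + be ^+ 2 * (x2 - x1) ^+ 2 ->
  (r2 - al ^+ 2 + be ^+ 2) * (x1 * x2) + (r2 + al ^+ 2 - be ^+ 2) * (y1 * y2)
  = r2 * (al ^+ 2 + be ^+ 2 - r2).
Proof.
move=> c1 c2 ne tg.
have d0 : r2 - (x1 * x2 + y1 * y2) != 0.
  apply: contra ne => /eqP d0.
  have : (x2 - x1) ^+ 2 + (y2 - y1) ^+ 2 = 0.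
    transitivity ((x1 ^+ 2 + y1 ^+ 2) + (x2 ^+ 2 + y2 ^+ 2)
      - 2 * (x1 * x2 + y1 * y2)); first by ring.
    by rewrite c1 c2 -[RHS](mulr0 2) -d0; ring.
  move/eqP; rewrite paddr_eq0 ?sqr_ge0// !sqrf_eq0 !subr_eq0.
  by move=> /andP[/eqP-> /eqP->].
apply/eqP; rewrite -subr_eq0; apply/eqP.
apply: (mulfI d0); rewrite mulr0.
have -> : (r2 - (x1 * x2 + y1 * y2)) *
    ((r2 - al ^+ 2 + be ^+ 2) * (x1 * x2) +
     (r2 + al ^+ 2 - be ^+ 2) * (y1 * y2) - r2 * (al ^+ 2 + be ^+ 2 - r2)) =
   r2 * ((r2 - (x1 * x2 + y1 * y2)) * (r2 + (x1 * x2 + y1 * y2))) -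
   (al ^+ 2 * ((r2 - y1 * y2) ^+ 2 - (x1 * x2) ^+ 2)
     + be ^+ 2 * ((r2 - x1 * x2) ^+ 2 - (y1 * y2) ^+ 2)) by ring.
have -> : (r2 - (x1 * x2 + y1 * y2)) * (r2 + (x1 * x2 + y1 * y2)) =
  (x1 * y2 - y1 * x2) ^+ 2.
  transitivity (r2 * r2 - (x1 * x2 + y1 * y2) ^+ 2); first by ring.
  by rewrite -{1}c1 -c2; ring.
have -> : (r2 - y1 * y2) ^+ 2 - (x1 * x2) ^+ 2 = r2 * (y2 - y1) ^+ 2.
  have -> : (x1 * x2) ^+ 2 = (r2 - y1 ^+ 2) * (r2 - y2 ^+ 2).
    by rewrite -{1}c1 -c2; ring.
  by ring.
have -> : (r2 - x1 * x2) ^+ 2 - (y1 * y2) ^+ 2 = r2 * (x2 - x1) ^+ 2.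
  have -> : (y1 * y2) ^+ 2 = (r2 - x1 ^+ 2) * (r2 - x2 ^+ 2).
    by rewrite -{1}c1 -c2; ring.
  by ring.
by rewrite tg; ring.
Qed.

(** P2 and P3 are the two points where the circle meets the polar line n.X = k of P1. Vieta's
    formulas express their sums and products through P1, and conjugacy of P2 and P3 then constrains
    k. The last hypothesis says that P1 is not conjugate to itself. *)
Lemma self_conjugate_triangle r2 m1 m2 k x1 y1 x2 y2 x3 y3 :
  0 < m1 -> 0 < m2 -> m1 + m2 = 2 * r2 ->
  x1 ^+ 2 + y1 ^+ 2 = r2 -> x2 ^+ 2 + y2 ^+ 2 = r2 -> x3 ^+ 2 + y3 ^+ 2 = r2 ->
  (x2, y2) != (x3, y3) ->
  m1 * (x1 * x2) + m2 * (y1 * y2) = k ->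
  m1 * (x2 * x3) + m2 * (y2 * y3) = k ->
  m1 * (x3 * x1) + m2 * (y3 * y1) = k ->
  m1 * x1 ^+ 2 + m2 * y1 ^+ 2 != k ->
  2 * k = - (m1 * m2) /\
  r2 * (x1 * x2 + y1 * y2 + (x2 * x3 + y2 * y3) + (x3 * x1 + y3 * y1))
  = k - r2 ^+ 2.
Proof.
move=> m1p m2p mS c1 c2 c3 ne e12 e23 e31 nk.
have r2p : 0 < r2 by lra.
set n1 := m1 * x1; set n2 := m2 * y1; set N := n1 ^+ 2 + n2 ^+ 2.
have l2 : n1 * x2 + n2 * y2 = k by rewrite -e12 /n1 /n2; ring.
have l3 : n1 * x3 + n2 * y3 = k by rewrite -e31 /n1 /n2; ring.
(* [P2 + P3] and the conormal [n] are both orthogonal to [P2 - P3]. *)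
have cross0 : n1 * (y2 + y3) - n2 * (x2 + x3) = 0.
  have dn : n1 * (x2 - x3) + n2 * (y2 - y3) = 0.
    by rewrite -[RHS](subrr k) -{1}l2 -l3; ring.
  have ds : (x2 + x3) * (x2 - x3) + (y2 + y3) * (y2 - y3) = 0.
    by rewrite -[RHS](subrr r2) -{1}c2 -c3; ring.
  have : (x2 - x3 != 0) || (y2 - y3 != 0).
    by rewrite !subr_eq0 -negb_and -xpair_eqE.
  case/orP => d0; apply: (mulIf d0); rewrite mul0r.
    transitivity ((y2 + y3) * (n1 * (x2 - x3) + n2 * (y2 - y3)) -
      n2 * ((x2 + x3) * (x2 - x3) + (y2 + y3) * (y2 - y3))); first by ring.
    by rewrite dn ds; ring.
  transitivity (n1 * ((x2 + x3) * (x2 - x3) + (y2 + y3) * (y2 - y3)) -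
    (x2 + x3) * (n1 * (x2 - x3) + n2 * (y2 - y3))); first by ring.
  by rewrite dn ds; ring.
(* By [cross0] the vector P2 + P3 is parallel to n, and its product with n is 2k. *)
have NX : N * (x2 + x3) = 2 * k * n1.
  transitivity (n1 * ((n1 * x2 + n2 * y2) + (n1 * x3 + n2 * y3))
    - n2 * (n1 * (y2 + y3) - n2 * (x2 + x3))); first by rewrite /N; ring.
  by rewrite cross0 l2 l3; ring.
have NY : N * (y2 + y3) = 2 * k * n2.
  transitivity (n2 * ((n1 * x2 + n2 * y2) + (n1 * x3 + n2 * y3))
    + n1 * (n1 * (y2 + y3) - n2 * (x2 + x3))); first by rewrite /N; ring.
  by rewrite cross0 l2 l3; ring.
(* Product of the roots of the quadratic that eliminating y from the line and the circle would
   give. *)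
have NXX : N * (x2 * x3) = k ^+ 2 - r2 * n2 ^+ 2.
  transitivity (N * (x2 + x3) * x2 - N * x2 ^+ 2); first by ring.
  rewrite NX -c2.
  transitivity (k ^+ 2 - (n2 ^+ 2 * x2 ^+ 2 + (k - n1 * x2) ^+ 2)).
    by rewrite /N; ring.
  by rewrite -{2}l2; ring.
have NYY : N * (y2 * y3) = k ^+ 2 - r2 * n1 ^+ 2.
  transitivity (N * (y2 + y3) * y2 - N * y2 ^+ 2); first by ring.
  rewrite NY -c2.
  transitivity (k ^+ 2 - (n1 ^+ 2 * y2 ^+ 2 + (k - n2 * y2) ^+ 2)).
    by rewrite /N; ring.
  by rewrite -{2}l2; ring.
set q := m1 * x1 ^+ 2 + m2 * y1 ^+ 2 in nk *.
have NE : N = r2 * (2 * q - m1 * m2).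
  transitivity ((m1 + m2) * q - m1 * m2 * (x1 ^+ 2 + y1 ^+ 2)).
    by rewrite /N /q /n1 /n2; ring.
  by rewrite mS c1; ring.
(* The relation between P2 and P3, multiplied by N, factors; the root k = q is the excluded
   self-conjugate case. *)
have kE : 2 * k = - (m1 * m2).
  have : r2 * ((2 * k + m1 * m2) * (k - q)) = 0.
    transitivity (m1 * (N * (x2 * x3)) + m2 * (N * (y2 * y3)) -
        N * (m1 * (x2 * x3) + m2 * (y2 * y3))); last by ring.
    rewrite e23 NXX NYY NE.
    transitivity ((m1 + m2) * k ^+ 2 - r2 * m1 * m2 * q
        - r2 * (2 * q - m1 * m2) * k); last by rewrite /q /n1 /n2; ring.
    by rewrite mS; ring.
  move/eqP; rewrite !mulf_eq0 (gt_eqF r2p)/= subr_eq0 [k == q]eq_sym (negbTE nk).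
  by rewrite orbF addr_eq0 => /eqP.
split=> //.
have N0 : N != 0.
  apply: lt0r_neq0.
  rewrite lt_neqAle addr_ge0 ?sqr_ge0// andbT eq_sym /N paddr_eq0 ?sqr_ge0//.
  rewrite !sqrf_eq0 /n1 /n2 !mulf_eq0 (gt_eqF m1p) (gt_eqF m2p)/=.
  apply/negP => /andP[/eqP x0 /eqP y0].
  by move: r2p; rewrite -c1 x0 y0 expr0n addr0 ltxx.
apply: (mulfI N0).
(* By [kE], N = 2 r2 (q + k), so q, the only trace of the position of P1, disappears with the factor
   N. *)
transitivity (r2 * (x1 * (N * (x2 + x3)) + y1 * (N * (y2 + y3)) +
   (N * (x2 * x3) + N * (y2 * y3)))); first by ring.
rewrite NX NY NXX NYY.
transitivity (r2 * (2 * k * q + 2 * k ^+ 2 - r2 * N)).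
  by rewrite /N /q /n1 /n2; ring.
by rewrite NE -[m1 * m2]opprK -kE; ring.
Qed.

End Conjugate.

(** * Tangents of an ellipse *)

Section Oval.
Variable R : realType.
Implicit Types (u o A B P N L X : R * R) (al be r : R).

(** Unlike in [ellipse], no order is imposed on the semi-axes, so scaling along u stays within this
    family whichever axis ends up longer. *)
Definition oval o u al be : set (R * R) :=
  [set X | (dot (X - o) u / al) ^+ 2 + (dot (X - o) (perp u) / be) ^+ 2 = 1].

Lemma enorm1_dot u : enorm u = 1 -> dot u u = 1.
Proof. by move=> u1; rewrite -enorm_sqr u1 expr1n. Qed.

Lemma dot_frame u (v w : R * R) : enorm u = 1 ->
  dot v u * dot w u + dot v (perp u) * dot w (perp u) = dot v w.
Proof.
move=> /enorm1_dot u1; transitivity (dot u u * dot v w); last by rewrite u1 mul1r.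
by rewrite /dot/=; ring.
Qed.

Lemma frame_inj u (v w : R * R) : enorm u = 1 ->
  dot v u = dot w u -> dot v (perp u) = dot w (perp u) -> v = w.
Proof.
move=> u1 e1 e2.
have E z : dot v z = dot w z by rewrite -!(dot_frame u _ z u1) e1 e2.
move: (E (1, 0)) (E (0, 1)); rewrite /dot/= !mulr1 !mulr0 !addr0 !add0r.
by case: v {e1 e2 E} => ? ?; case: w => ? ? /= -> ->.
Qed.

Lemma ccurve_dot (C : circle R) X : 0 <= radius C ->
  ccurve C X <-> dot (X - center C) (X - center C) = radius C ^+ 2.
Proof.
move=> r0; rewrite /ccurve/=; split => [<-|e]; first by rewrite enorm_sqr.
by rewrite /enorm e sqrtr_sqr ger0_norm.
Qed.

Lemma ccurve_oval u o r : enorm u = 1 -> 0 < r ->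
  ccurve (Circle o r) = oval o u r r.
Proof.
move=> u1 r0; apply/seteqP; split => X; rewrite ccurve_dot ?ltW//= /oval/=
  -(dot_frame u (X - o) (X - o) u1) -!expr2 !expr_div_n -mulrDl.
  by move=> ->; rewrite divff// expf_neq0// gt_eqF.
by move=> /divr1_eq.
Qed.

(* The identity says that the discriminant of the quadratic polynomial cutting
   [oval] on the line vanishes. *)
Lemma tangent_oval o u al be A B : enorm u = 1 -> 0 < al -> 0 < be -> A != B ->
  tangent (line A B) (oval o u al be) <->
  (dot (A - o) u * dot (B - o) (perp u) - dot (A - o) (perp u) * dot (B - o) u) ^+ 2
  = al ^+ 2 * (dot (B - o) (perp u) - dot (A - o) (perp u)) ^+ 2
    + be ^+ 2 * (dot (B - o) u - dot (A - o) u) ^+ 2.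
Proof.
move=> u1 al0 be0 AB.
set x1 := dot (A - o) u; set y1 := dot (A - o) (perp u).
set x2 := dot (B - o) u; set y2 := dot (B - o) (perp u).
set dx := x2 - x1; set dy := y2 - y1.
pose a := (dx / al) ^+ 2 + (dy / be) ^+ 2.
pose b := (x1 / al) * (dx / al) + (y1 / be) * (dy / be).
pose c := (x1 / al) ^+ 2 + (y1 / be) ^+ 2 - 1.
have alN : al != 0 by rewrite gt_eqF.
have beN : be != 0 by rewrite gt_eqF.
have a0 : 0 < a.
  rewrite lt_neqAle addr_ge0 ?sqr_ge0// andbT eq_sym /a paddr_eq0 ?sqr_ge0//.
  rewrite !sqrf_eq0 !mulf_eq0 !invr_eq0 (negbTE alN) (negbTE beN) !orbF !subr_eq0.
  apply: contra AB => /andP[/eqP ex /eqP ey]; apply/eqP.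
  by apply: (addIr (- o)); exact: frame_inj u1 (esym ex) (esym ey).
have aN : a != 0 by rewrite gt_eqF.
have lineE t : oval o u al be (A + t *: (B - A)) <-> a * t ^+ 2 + 2 * b * t + c = 0.
  rewrite /oval/=.
  have -> : dot (A + t *: (B - A) - o) u = x1 + t * dx.
    by rewrite /dx /x1 /x2 /dot/= /GRing.scale/=; ring.
  have -> : dot (A + t *: (B - A) - o) (perp u) = y1 + t * dy.
    by rewrite /dy /y1 /y2 /dot/= /GRing.scale/=; ring.
  have -> : a * t ^+ 2 + 2 * b * t + c =
    ((x1 + t * dx) / al) ^+ 2 + ((y1 + t * dy) / be) ^+ 2 - 1.
    by rewrite /a /b /c; ring.
  by split => [->|/eqP]; [rewrite subrr|rewrite subr_eq0 => /eqP].
have line_inj t t' : A + t *: (B - A) = A + t' *: (B - A) -> t = t'.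
  move=> /addrI/eqP; rewrite -subr_eq0 -scalerBl scaler_eq0 !subr_eq0.
  by rewrite [B == A]eq_sym (negbTE AB) orbF => /eqP.
have discE : (x1 * y2 - y1 * x2) ^+ 2 - (al ^+ 2 * dy ^+ 2 + be ^+ 2 * dx ^+ 2)
    = - (al * be) ^+ 2 * (b ^+ 2 - a * c).
  by rewrite /a /b /c /dx /dy; field; rewrite alN beN.
have -> : ((x1 * y2 - y1 * x2) ^+ 2 = al ^+ 2 * dy ^+ 2 + be ^+ 2 * dx ^+ 2)
    <-> b ^+ 2 - a * c = 0.
  split=> [|d0]; last first.
    by apply/eqP; rewrite -subr_eq0 discE d0 mulr0.
  move/eqP; rewrite -subr_eq0 discE mulf_eq0 oppr_eq0 sqrf_eq0 mulf_eq0.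
  by rewrite (negbTE alN) (negbTE beN) => /eqP.
split=> [[X [[/= [t _ <-] /lineE rt] uX]]|d0].
  (* By Vieta, -2b/a - t is the other root; uniqueness of the common point makes it equal to t. *)
  have /line_inj t't : A + t *: (B - A) = A + (- (2 * b / a) - t) *: (B - A).
    apply: uX; split; first by exists (- (2 * b / a) - t).
    by apply/lineE; rewrite -[RHS]rt; field.
  have bE : b = - (a * t).
    have : a * t = a * (- (2 * b / a) - t) by rewrite -t't.
    by rewrite mulrBr mulrN (mulrC a (_ / _)) divfK//; lra.
  transitivity (- a * (a * t ^+ 2 + 2 * b * t + c)); last by rewrite rt mulr0.
  by rewrite bE; ring.
exists (A + (- (b / a)) *: (B - A)); split.
  split; first by exists (- (b / a)).
  apply/lineE; apply: (mulfI aN); rewrite mulr0.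
  by transitivity (- (b ^+ 2 - a * c)); [field|rewrite d0 oppr0].
move=> _ [/= [t _ <-] /lineE rt]; congr (A + _ *: _).
have /eqP : (a * t + b) ^+ 2 = 0.
  transitivity (a * (a * t ^+ 2 + 2 * b * t + c) + (b ^+ 2 - a * c)); first by ring.
  by rewrite rt d0 mulr0 addr0.
rewrite sqrf_eq0 addr_eq0 => /eqP at_b.
by apply: (mulfI aN); rewrite mulrN (mulrC a) divfK// at_b.
Qed.

End Oval.
Arguments oval {R}.

(** * Fregier circles *)

Section Fregier.
Variable R : realType.
Implicit Types (C : circle R) (P N L : R * R).

Lemma dot_sqr_le (v w : R * R) : dot v w ^+ 2 <= dot v v * dot w w.
Proof.
rewrite -subr_ge0; have -> : dot v v * dot w w - dot v w ^+ 2 = dot (perp v) w ^+ 2.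
  by rewrite /dot/=; ring.
exact: sqr_ge0.
Qed.

Lemma vangle_cosine_itv (v w : R * R) :
  -1 <= dot v w / (enorm v * enorm w) <= 1.
Proof.
rewrite -ler_norml -(expr_le1 (n := 2))// real_normK ?num_real//.
rewrite expr_div_n exprMn !enorm_sqr.
have : 0 <= dot v v * dot w w by rewrite mulr_ge0 ?dot_ge0.
(* If one of the vectors is zero, the quotient is 0 since the inverse of 0 is 0. *)
rewrite le_eqVlt => /predU1P[<-|d0]; first by rewrite invr0 mulr0.
by rewrite ler_pdivrMr// mul1r dot_sqr_le.
Qed.

Lemma cos_vangle (v w : R * R) :
  cos (vangle v w) = dot v w / (enorm v * enorm w).
Proof. by rewrite acosK// in_itv/= vangle_cosine_itv. Qed.

Lemma chord_sqr_length C N L : 0 <= radius C -> ccurve C N -> ccurve C L ->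
  dot (N - L) (N - L) =
  2 * (radius C ^+ 2 - dot (N - center C) (L - center C)).
Proof.
move=> r0 /(ccurve_dot _ _ _ r0) cN /(ccurve_dot _ _ _ r0) cL.
transitivity (dot (N - center C) (N - center C) + dot (L - center C) (L - center C)
   - 2 * dot (N - center C) (L - center C)).
  by rewrite /dot/=; ring.
by rewrite cN cL; ring.
Qed.

Lemma dot_eq0 (v : R * R) : dot v v = 0 -> v = 0.
Proof.
case: v => x y; rewrite /dot/= -!expr2 => /eqP.
by rewrite paddr_eq0 ?sqr_ge0// !sqrf_eq0 => /andP[/eqP-> /eqP->].
Qed.

Lemma chord_neq0 C N L : 0 <= radius C -> ccurve C N -> ccurve C L -> N != L ->
  radius C ^+ 2 - dot (N - center C) (L - center C) != 0.
Proof.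
move=> r0 cN cL; apply: contra => /eqP d0; rewrite -subr_eq0; apply/eqP/dot_eq0.
by rewrite (chord_sqr_length _ _ _ r0 cN cL) d0 mulr0.
Qed.

(** Three vectors of the plane are linearly dependent, so their Gram determinant vanishes. *)
Lemma gram3 (p n l : R * R) :
  dot p p * dot n n * dot l l + 2 * dot n l * dot n p * dot l p
  = dot n n * dot l p ^+ 2 + dot l l * dot n p ^+ 2 + dot p p * dot n l ^+ 2.
Proof. by rewrite /dot; ring. Qed.

(* [sqrt ((r ^+ 2 + n . l) / 2)] is the distance from the center to the chord. *)
Lemma inscribed_angle C P N L : 0 < radius C ->
  ccurve C P -> ccurve C N -> ccurve C L -> N != P -> L != P ->
  (radius C * cos (internal_angle P N L)) ^+ 2 =
  (radius C ^+ 2 + dot (N - center C) (L - center C)) / 2.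
Proof.
move=> r0 cP cN cL NP LP; have r0' := ltW r0.
rewrite exprMn /internal_angle cos_vangle expr_div_n exprMn !enorm_sqr.
rewrite !(chord_sqr_length C)//.
have := chord_neq0 _ _ _ r0' cN cP NP; have := chord_neq0 _ _ _ r0' cL cP LP.
have -> : dot (N - P) (L - P) = dot (N - center C) (L - center C)
  - dot (N - center C) (P - center C) - dot (L - center C) (P - center C)
  + dot (P - center C) (P - center C) by rewrite /dot/=; ring.
have := gram3 (P - center C) (N - center C) (L - center C).
move: cP cN cL => /(ccurve_dot _ _ _ r0')-> /(ccurve_dot _ _ _ r0')->.
move=> /(ccurve_dot _ _ _ r0')->.
set x := dot (N - _) (L - _); set y := dot (N - _) _; set z := dot (L - _) _.
have : radius C ^+ 2 != 0 by rewrite expf_neq0// gt_eqF.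
move: (radius C ^+ 2) => r2 r2N gram z0 y0.
(* All three vectors have squared length r2, and the two sides differ by their Gram determinant up
   to sign. *)
have key : r2 * (x - y - z + r2) ^+ 2 = 2 * (r2 - y) * (r2 - z) * (r2 + x).
  apply/eqP; rewrite -subr_eq0; apply/eqP.
  transitivity ((r2 * z ^+ 2 + r2 * y ^+ 2 + r2 * x ^+ 2) -
    (r2 * r2 * r2 + 2 * x * y * z)); first by ring.
  by rewrite gram subrr.
rewrite mulrA key; field; exact/andP.
Qed.

(** In the criterion of [tangent_oval] with equal semi-axes, both sides carry the factor R^2 - N.L,
    with R the radius of C and vectors taken from the center. It is nonzero for distinct endpoints
    and cancels. *)
Lemma chord_tangent_concentric C N L r : 0 < radius C -> 0 < r ->
  ccurve C N -> ccurve C L -> N != L ->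
  tangent (line N L) (ccurve (Circle (center C) r)) <->
  r ^+ 2 = (radius C ^+ 2 + dot (N - center C) (L - center C)) / 2.
Proof.
move=> rC r0 cN cL NL.
have u1 : enorm ((1, 0) : R * R) = 1.
  by rewrite /enorm /dot/= mulr1 mulr0 addr0 sqrtr1.
rewrite (ccurve_oval _ (1, 0) _ _ u1 r0) tangent_oval// -mulrDr.
have := chord_neq0 _ _ _ (ltW rC) cN cL NL.
move: (cN) (cL) => /(ccurve_dot _ _ _ (ltW rC)) dN /(ccurve_dot _ _ _ (ltW rC)) dL.
have := chord_sqr_length _ _ _ (ltW rC) cN cL.
set d := dot (N - center C) (L - center C) => dNL d0.
set lhs := (X in X = _); set s := (X in _ ^+ 2 * X).
have -> : lhs = (radius C ^+ 2 - d) * (radius C ^+ 2 + d).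
  transitivity (radius C ^+ 2 * radius C ^+ 2 - d ^+ 2); last by ring.
  by rewrite -{1}dN -dL /lhs /d /dot/=; ring.
have -> : s = 2 * (radius C ^+ 2 - d) by rewrite -dNL /s /dot/=; ring.
split=> [e|->]; last by field.
apply: (mulfI d0); apply: (mulfI (_ : 2 != 0 :> R)); first by [].
by transitivity (r ^+ 2 * (2 * (radius C ^+ 2 - d))); [ring|rewrite -e; field].
Qed.

Lemma fregier_area C P N L : 0 < radius C ->
  ccurve C P -> ccurve C N -> ccurve C L -> N != P -> L != P -> N != L ->
  area (fregier_circle C P (internal_angle P N L)) =
  (pi * ((radius C ^+ 2 + dot (N - center C) (L - center C)) / 2))%:E.
Proof.
move=> r0 cP cN cL NP LP NL; rewrite -(inscribed_angle _ P)//.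
set th := internal_angle P N L.
rewrite /fregier_circle /fregier_radius; case: eqP => [->|thN].
  by rewrite area_circle// cos_pihalf mulr0.
(* [th] is by definition an [acos], so a zero cosine would make it pi/2. *)
have c0 : cos th != 0.
  apply/eqP => c0; apply: thN; move: c0; rewrite cos_vangle /th => c0.
  by rewrite /internal_angle /vangle c0 acos0.
have R0 : 0 < radius C * `|cos th| by rewrite mulr_gt0// normr_gt0.
set g := get _; have -> : g = radius C * `|cos th|; last first.
  by rewrite area_circle ?ltW// exprMn real_normK ?num_real// -exprMn.
(* Uniqueness comes from the chord NL itself, which is seen under the angle [th]; existence from
   [inscribed_angle], by which all chords seen under [th] lie at the same distance from the
   center. *)
apply: get_unique; last first.
- move=> r [rp tr]; apply/eqP; rewrite -(eqrXn2 (n := 2)) ?ltW//.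
  rewrite exprMn real_normK ?num_real// -exprMn (inscribed_angle _ P)//.
  by apply/eqP/(chord_tangent_concentric C) => //; exact: tr.
- split=> // N' L' cN' cL' NP' LP' NL' th'.
  apply/chord_tangent_concentric => //.
  by rewrite -(inscribed_angle _ P)// th' !exprMn real_normK ?num_real.
Qed.

End Fregier.

(** * Concentric Poncelet triangles and the caustic *)

Section Config.
Variable R : realType.
Implicit Types (C : circle R) (D E K : ellipse R).

Lemma triangle_neq (A B D : R * R) : is_triangle A B D ->
  [/\ A != B, B != D & D != A].
Proof.
rewrite /is_triangle => t; split; apply: contra t => /eqP ->;
  by rewrite /dot/=; apply/eqP; ring.
Qed.

(** The vertices o + al u and o + be (perp u) lie on the oval, at distances al and be from o. *)
Lemma oval_in_circle u o (al be r : R) : enorm u = 1 -> 0 < al -> 0 < be ->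
  (forall X, oval o u al be X -> enorm (X - o) < r) -> al < r /\ be < r.
Proof.
move=> u1 al0 be0 hin; have uu := enorm1_dot _ _ u1.
have up : dot u (perp u) = 0 by rewrite /dot/=; ring.
have pu : dot (perp u) u = 0 by rewrite /dot/=; ring.
have pp : dot (perp u) (perp u) = 1 by rewrite -uu /dot/=; ring.
have dZ c (v w : R * R) : dot (c *: v) w = c * dot v w.
  by rewrite /dot/= /GRing.scale/=; ring.
have nZ c (v : R * R) : 0 < c -> dot v v = 1 -> enorm (c *: v) = c.
  move=> c0 v1; rewrite /enorm dZ -[dot v _]mulr1.
  have -> : dot v (c *: v) = c * dot v v by rewrite /dot/= /GRing.scale/=; ring.
  by rewrite v1 !mulr1 -expr2 sqrtr_sqr gtr0_norm.
split.
- have := hin (o + al *: u); rewrite addrAC subrr add0r nZ//; apply.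
  rewrite /oval/= addrAC subrr add0r !dZ uu up mulr1 mulr0 mul0r divff ?gt_eqF//.
  by rewrite expr1n expr0n addr0.
- have := hin (o + be *: perp u); rewrite addrAC subrr add0r nZ//; apply.
  rewrite /oval/= addrAC subrr add0r !dZ pu pp mulr1 mulr0 mul0r divff ?gt_eqF//.
  by rewrite expr1n expr0n add0r.
Qed.

(** The frame u is left free because the same curve is used both in the frame of D and in that of
    the billiard ellipse. *)
Lemma poncelet3_oval C u (al be : R) P1 P2 P3 : 0 < radius C ->
  enorm u = 1 -> 0 < al < radius C -> 0 < be < radius C ->
  is_triangle P1 P2 P3 -> inscribed (ccurve C) P1 P2 P3 ->
  circumscribed (oval (center C) u al be) P1 P2 P3 ->
  al + be = radius C /\
  fregier_area_sum C P1 P2 P3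
  = (pi * ((radius C ^+ 2 + al ^+ 2 + be ^+ 2) / 2))%:E.
Proof.
move=> r0 u1 /andP[al0 alr] /andP[be0 ber] /triangle_neq[N12 N23 N31] [c1 c2 c3].
case; rewrite !tangent_oval//.
rewrite /fregier_area_sum !fregier_area//; try by rewrite eq_sym.
have fr P Q : P != Q -> (dot (P - center C) u, dot (P - center C) (perp u)) !=
    (dot (Q - center C) u, dot (Q - center C) (perp u)).
  apply: contra => /eqP[e1 e2]; apply/eqP.
  by apply: (addIr (- center C)); exact: (frame_inj _ u).
move: (fr _ _ N12) (fr _ _ N23) (fr _ _ N31).
move: c1 c2 c3 => /(ccurve_dot _ _ _ (ltW r0)) c1 /(ccurve_dot _ _ _ (ltW r0)) c2
  /(ccurve_dot _ _ _ (ltW r0)) c3.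
move: c1 c2 c3; rewrite -!(dot_frame _ u (_ - center C) (_ - center C) u1) -!expr2.
move: (dot (P1 - _) u) (dot (P1 - _) (perp u)) => x1 y1.
move: (dot (P2 - _) u) (dot (P2 - _) (perp u)) => x2 y2.
move: (dot (P3 - _) u) (dot (P3 - _) (perp u)) => x3 y3.
move=> c1 c2 c3 n12 n23 n31 t12 t23 t31.
set r2 := radius C ^+ 2 in c1 c2 c3 *.
have al2 : al ^+ 2 < r2 by rewrite ltr_sqr// nnegrE ltW.
have be2 : be ^+ 2 < r2 by rewrite ltr_sqr// nnegrE ltW.
have al20 : 0 <= al ^+ 2 by exact: sqr_ge0.
have be20 : 0 <= be ^+ 2 by exact: sqr_ge0.
have r20 : 0 < r2 by rewrite exprn_gt0.
have := self_conjugate_triangle _ r2 (r2 - al ^+ 2 + be ^+ 2)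
  (r2 + al ^+ 2 - be ^+ 2) (r2 * (al ^+ 2 + be ^+ 2 - r2)) x1 y1 x2 y2 x3 y3.
case => //; [lra|lra|lra|exact: circle_chord_conjugate..| |].
  (* P1 is not self-conjugate: the form at P1 minus k equals this quantity, positive because al and
     be are below the radius. *)
  have : 0 < 2 * (r2 * r2 - al ^+ 2 * x1 ^+ 2 - be ^+ 2 * y1 ^+ 2).
    rewrite -{2}c1 mulr_gt0// mulrDr.
    have h1 : al ^+ 2 * x1 ^+ 2 <= r2 * x1 ^+ 2 by rewrite ler_wpM2r ?sqr_ge0 ?ltW.
    have h2 : be ^+ 2 * y1 ^+ 2 <= r2 * y1 ^+ 2 by rewrite ler_wpM2r ?sqr_ge0 ?ltW.
    have : (0 < x1 ^+ 2) || (0 < y1 ^+ 2).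
      rewrite !lt0r !sqr_ge0 !andbT -negb_and; apply/negP => /andP[/eqP a /eqP b].
      by move: r20; rewrite -c1 a b addr0 ltxx.
    case/orP => h.
      have : al ^+ 2 * x1 ^+ 2 < r2 * x1 ^+ 2 by rewrite ltr_pM2r.
      lra.
    have : be ^+ 2 * y1 ^+ 2 < r2 * y1 ^+ 2 by rewrite ltr_pM2r.
    lra.
  have -> : 2 * (r2 * r2 - al ^+ 2 * x1 ^+ 2 - be ^+ 2 * y1 ^+ 2) =
    (r2 - al ^+ 2 + be ^+ 2) * x1 ^+ 2 + (r2 + al ^+ 2 - be ^+ 2) * y1 ^+ 2 -
    r2 * (al ^+ 2 + be ^+ 2 - r2).
    by rewrite -c1; ring.
  by rewrite subr_gt0 lt_neqAle eq_sym => /andP[].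
move=> kE sE; split.
  (* This is 2k = -(m1 m2) rearranged. The second factor is nonzero since al and be lie strictly
     between 0 and the radius. *)
  have /eqP : (r2 - (al + be) ^+ 2) * (r2 - (al - be) ^+ 2) = 0 by lra.
  rewrite [r2 - (al - be) ^+ 2]subr_sqr !mulf_eq0.
  have -> : (radius C - (al - be) == 0) = false by apply/negbTE/lt0r_neq0; lra.
  have -> : (radius C + (al - be) == 0) = false by apply/negbTE/lt0r_neq0; lra.
  rewrite !orbF.
  rewrite subr_eq0 eqrXn2 ?ltW ?addr_gt0//.
  by move=> /eqP ->.
congr (_%:E); rewrite -!mulrDr -!mulrDl; congr (_ * (_ / _)).
have sE' : x1 * x2 + y1 * y2 + (x2 * x3 + y2 * y3) + (x3 * x1 + y3 * y1) =
    al ^+ 2 + be ^+ 2 - 2 * r2.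
  by apply: (mulfI (lt0r_neq0 r20)); rewrite sE; ring.
lra.
Qed.

(** * Scaling along the major axis, confocality and the parameter [h] *)

Definition frame_point E x y : R * R :=
  ecenter E + x *: axis E + y *: perp (axis E).

Lemma frame_pointE E x y : xcoord E (frame_point E x y) = x /\
  ycoord E (frame_point E x y) = y.
Proof.
have := enorm1_dot _ _ (axis_unit E).
rewrite /xcoord /ycoord /frame_point; case: (axis E) => u v.
case: (ecenter E) => p q; rewrite /dot/= /GRing.scale/= => uv.
by split; rewrite -[RHS]mulr1 -uv; ring.
Qed.

Lemma coord_inj E X Y : xcoord E X = xcoord E Y -> ycoord E X = ycoord E Y -> X = Y.
Proof.
move=> ex ey; apply: (addIr (- ecenter E)).
exact: frame_inj (axis_unit E) ex ey.
Qed.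

Lemma major_scaling_oval E (al be : R) :
  major_scaling E @` oval (ecenter E) (axis E) al be =
  oval (ecenter E) (axis E) (smin E / smaj E * al) be.
Proof.
have b0 := smin_gt0 E; have a0 := lt_le_trans b0 (smin_le_smaj E).
have aN : smaj E != 0 by rewrite gt_eqF.
have bN : smin E != 0 by rewrite gt_eqF.
have sc X : major_scaling E X =
    frame_point E (smin E / smaj E * xcoord E X) (ycoord E X) by [].
have cE (x : R) : smin E / smaj E * x / (smin E / smaj E * al) = x / al.
  by rewrite -mulf_div divff ?mul1r// mulf_neq0 ?invr_eq0.
apply/seteqP; split => [_ [X hX <-]|Y hY].
  rewrite sc /oval/= -/(xcoord _ _) -/(ycoord _ _).
  by rewrite !(frame_pointE E _ _).1 !(frame_pointE E _ _).2 cE.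
exists (frame_point E (smaj E / smin E * xcoord E Y) (ycoord E Y)).
  rewrite /oval/= -/(xcoord _ _) -/(ycoord _ _).
  rewrite !(frame_pointE E _ _).1 !(frame_pointE E _ _).2 -(cE (_ * _)) mulrA.
  by rewrite mulf_div [smaj E * _]mulrC divff ?mulf_neq0// mul1r.
rewrite sc; apply: (coord_inj E);
  rewrite ?(frame_pointE E _ _).1 ?(frame_pointE E _ _).2//.
by rewrite mulrA mulf_div [smaj E * _]mulrC divff ?mulf_neq0// mul1r.
Qed.

(** The four points of the first circle in the coordinate directions lie on the second; subtracting
    the equations of opposite points identifies the centers. *)
Lemma ccurve_inj o r C : 0 < r -> 0 < radius C ->
  ccurve (Circle o r) = ccurve C -> o = center C /\ r = radius C.
Proof.
move=> r0 rC eqC.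
have onC (v : R * R) : dot v v = 1 ->
    dot (o + r *: v - center C) (o + r *: v - center C) = radius C ^+ 2.
  move=> v1; apply/(ccurve_dot R C) => //; first exact: ltW.
  rewrite -eqC; apply/ccurve_dot => /=; first exact: ltW.
  rewrite -[RHS]mulr1 -v1 /dot/= /GRing.scale/=; ring.
have := onC (1, 0); have := onC (-1, 0); have := onC (0, 1); have := onC (0, -1).
rewrite /dot/= /GRing.scale/=
  !(mulr0, mul0r, addr0, add0r, mulr1, mul1r, mulrN1, mulN1r, opprK).
case: o eqC onC => p q _ _; case: (center C) => s t /=.
move=> /(_ erefl) e1 /(_ erefl) e2 /(_ erefl) e3 /(_ erefl) e4.
have ps : p = s.
  have : r * (p - s) = 0 by lra.
  by move/eqP; rewrite mulf_eq0 (gt_eqF r0)/= subr_eq0 => /eqP.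
have qt : q = t.
  have : r * (q - t) = 0 by lra.
  by move/eqP; rewrite mulf_eq0 (gt_eqF r0)/= subr_eq0 => /eqP.
split; first by rewrite ps qt.
apply/eqP; rewrite -(eqrXn2 (n := 2)) ?ltW//; apply/eqP; rewrite -e4 ps qt; ring.
Qed.

(** Recovers the center and, up to sign, the focal vector from the unordered pair of foci. Each way
    of matching the points is a linear system. *)
Lemma symmetric_pair_eq (o f o' g : R * R) :
  [set o + f; o - f] = [set o' + g; o' - g] -> o' = o /\ (g = f \/ g = - f).
Proof.
case: o f o' g => [p q] [f1 f2] [p' q'] [g1 g2] fg.
have m X : X = (p, q) + (f1, f2) \/ X = (p, q) - (f1, f2) <->
   X = (p', q') + (g1, g2) \/ X = (p', q') - (g1, g2).
  by move: fg => /seteqP[a b]; split; [move/a|move/b].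
have [/(_ (or_introl erefl)) h1 _] := m ((p, q) + (f1, f2)).
have [/(_ (or_intror erefl)) h2 _] := m ((p, q) - (f1, f2)).
have [_ /(_ (or_introl erefl)) h3] := m ((p', q') + (g1, g2)).
have [_ /(_ (or_intror erefl)) h4] := m ((p', q') - (g1, g2)).
have pE (v w : R * R) : v.1 = w.1 -> v.2 = w.2 -> v = w.
  by case: v w => ? ? [? ?] /= -> ->.
case: h1 => -[] ? ?; case: h2 => -[] ? ?; case: h3 => -[] ? ?; case: h4 => -[] ? ?.
all: split; [apply: pE => /=; lra|
  first [left; apply: pE => /=; lra|right; apply: pE => /=; lra]].
Qed.

Lemma oval_axisN o u (al be : R) : oval o (- u) al be = oval o u al be.
Proof.
have dN (v w : R * R) : dot v (- w) = - dot v w by rewrite /dot/=; ring.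
have pN (v : R * R) : perp (- v) = - perp v by [].
by apply/seteqP; split => X; rewrite /oval/= pN !dN !mulNr !sqrrN.
Qed.

(** Brings K into the frame of E: equal foci give the same center, the same focal distance and, when
    that distance is nonzero, the same axis up to sign. *)
Lemma confocal_oval E K : confocal E K ->
  [/\ ecenter K = ecenter E,
      smaj K ^+ 2 - smin K ^+ 2 = smaj E ^+ 2 - smin E ^+ 2 &
      ecurve K = oval (ecenter E) (axis E) (smaj K) (smin K)].
Proof.
rewrite /confocal /foci.
have sq (F : ellipse R) : 0 <= smaj F ^+ 2 - smin F ^+ 2.
  rewrite subr_ge0 lerXn2r ?nnegrE ?smin_le_smaj// ltW ?smin_gt0//.
  exact: lt_le_trans (smin_gt0 F) (smin_le_smaj F).
set f := Num.sqrt _ *: axis E; set g := Num.sqrt _ *: axis K => fg.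
have [oE ef] : ecenter K = ecenter E /\ (g = f \/ g = - f).
  exact: symmetric_pair_eq.
have dE : dot g g = dot f f by case: ef => ->; rewrite /dot/=; ring.
have dd (F : ellipse R) c :
    dot (Num.sqrt c *: axis F) (Num.sqrt c *: axis F) = Num.sqrt c ^+ 2.
  rewrite -[RHS]mulr1 -(enorm1_dot _ _ (axis_unit F)) /dot/= /GRing.scale/=; ring.
move: dE; rewrite !dd !sqr_sqrtr// => dE.
split=> //.
(* With coinciding foci the axes may be unrelated, but K is a circle and so an oval in every
   frame. *)
have [c0|cN] := eqVneq (smaj K ^+ 2 - smin K ^+ 2) 0.
  have K0 := smin_gt0 K; have K1 := lt_le_trans K0 (smin_le_smaj K).
  have kE : smaj K = smin K.
    by apply/eqP; rewrite -(eqrXn2 (n := 2)) ?ltW// -subr_eq0 c0.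
  rewrite kE -ccurve_oval ?axis_unit// -oE (ccurve_oval _ (axis K)) ?axis_unit//.
  by rewrite -{1}kE.
have sN : Num.sqrt (smaj K ^+ 2 - smin K ^+ 2) != 0.
  by rewrite sqrtr_eq0 -ltNge lt_neqAle sq eq_sym cN.
have axE : axis K = axis E \/ axis K = - axis E.
  case: ef; rewrite /f /g -dE => h; [left|right]; apply: (scalerI sN) => //.
  by rewrite h scalerN.
rewrite -oE; case: axE => [<-//|/(congr1 -%R)].
by rewrite opprK => <-; rewrite oval_axisN.
Qed.

(** After cross-multiplication the difference factors as 4 (h' - h) (3 + h h'), and the last factor
    is positive. *)
Lemma h_param_unique (a b h : R) : 0 < b -> h_param a b h -> unique (h_param a b) h.
Proof.
move=> b0 hh; split=> // h' [h'0 h'1 e']; case: hh => h0 h1; rewrite e' => /eqP.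
rewrite eqr_div; last 2 first.
- by rewrite mulf_neq0 ?gt_eqF//; lra.
- by rewrite mulf_neq0 ?gt_eqF//; lra.
rewrite -subr_eq0.
have -> : (1 + h') * (3 - h') * ((1 - h) * (3 + h)) -
  (1 + h) * (3 - h) * ((1 - h') * (3 + h')) = 4 * (h' - h) * (3 + h * h') by ring.
have : 0 <= h * h' by rewrite mulr_ge0.
move=> hh; rewrite !mulf_eq0 subr_eq0 => /orP[/orP[|/eqP->//]|].
  by rewrite pnatr_eq0.
by rewrite gt_eqF//; lra.
Qed.

Lemma caustic_h_param (a b ak bk : R) : 0 < b -> b <= a -> 0 < ak -> 0 < bk ->
  ak ^+ 2 - bk ^+ 2 = a ^+ 2 - b ^+ 2 -> b / a * ak + bk = b ->
  exists h, [/\ h_param a b h, b / a * ak = b * (1 + h) / 2 & bk = b * (1 - h) / 2].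
Proof.
move=> b0 ab ak0 bk0 conf sum.
have a0 : 0 < a by exact: lt_le_trans ab.
have aN : a != 0 by rewrite gt_eqF.
have bN : b != 0 by rewrite gt_eqF.
(* Chosen so that bk = b (1 - h) / 2; the closing condition then gives ak = a (1 + h) / 2. *)
pose h := 1 - 2 * (bk / b).
have bkE : bk = b * (1 - h) / 2 by rewrite /h; field.
have akE : ak = a * (1 + h) / 2.
  apply: (mulfI (_ : b / a != 0)); first by rewrite mulf_neq0 ?invr_eq0.
  by apply: (addIr bk); rewrite sum bkE; field.
exists h; split=> //; last by rewrite akE; field.
have h1 : 0 < 1 - h by move: bk0; rewrite bkE; nra.
have h2 : 0 < 1 + h by move: ak0; rewrite akE; nra.
(* Confocality in terms of h, using 4 - (1 + h)^2 = (1 - h)(3 + h) and its analogue for -h. *)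
have key : a ^+ 2 * ((1 - h) * (3 + h)) = b ^+ 2 * ((1 + h) * (3 - h)).
  by move: conf; rewrite akE bkE; lra.
have d0 : 0 < (1 - h) * (3 + h) by rewrite mulr_gt0//; lra.
split; last 2 first.
- lra.
- by rewrite expr_div_n; apply/eqP; rewrite eqr_div ?expf_neq0 ?(gt_eqF d0)//
  key mulrC.
(* With [key], b <= a yields (1 - h)(3 + h) <= (1 + h)(3 - h), that is h >= 0. *)
have : b ^+ 2 * ((1 - h) * (3 + h)) <= a ^+ 2 * ((1 - h) * (3 + h)).
  by rewrite ler_pM2r// ler_sqr ?nnegrE ?(ltW a0) ?(ltW b0).
rewrite key ler_pM2l ?exprn_gt0//; lra.
Qed.

End Config.

Theorem proposition6 (R : realType) (C : circle R) (D : ellipse R)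
    (C_gt0 : 0 < radius C)
    (CD_concentric : ecenter D = center C)
    (D_in_C : inside D C)
    (CD_poncelet : exists P1 P2 P3, poncelet3 C D P1 P2 P3) :
  exists s : R,
    (forall P1 P2 P3, poncelet3 C D P1 P2 P3 ->
       fregier_area_sum C P1 P2 P3 = s%:E) /\
    (forall E K : ellipse R, is_caustic E K ->
       major_scaling E @` ecurve E = ccurve C ->
       major_scaling E @` ecurve K = ecurve D ->
       exists h : R, unique (h_param (smaj E) (smin E)) h /\
         let rho := (1 - h ^+ 2) / 2 in
         s = pi * smin E ^+ 2 * (1 - rho / 2)).
Proof.
have smaj_gt0 (F : ellipse R) : 0 < smaj F.
  exact: lt_le_trans (smin_gt0 F) (smin_le_smaj F).
have sum_eq u (al be : R) : enorm u = 1 -> 0 < al -> 0 < be ->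
    ecurve D = oval (center C) u al be ->
    forall P1 P2 P3, poncelet3 C D P1 P2 P3 -> al + be = radius C /\
      fregier_area_sum C P1 P2 P3
      = (pi * ((radius C ^+ 2 + al ^+ 2 + be ^+ 2) / 2))%:E.
  move=> u1 al0 be0 DE P1 P2 P3 [tri ins]; rewrite DE => circ.
  have [alr ber] : al < radius C /\ be < radius C.
    apply: (oval_in_circle R u (center C)) => // X; rewrite -DE; exact: D_in_C.
  by apply: (poncelet3_oval R C u) => //; apply/andP.
have sumD := sum_eq _ _ _ (axis_unit D) (smaj_gt0 D) (smin_gt0 D).
rewrite -CD_concentric in sumD; have {}sumD := sumD erefl.
exists (pi * ((radius C ^+ 2 + smaj D ^+ 2 + smin D ^+ 2) / 2)); split.
  by move=> P1 P2 P3 /sumD[].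
move=> E K [conf _] EC KD.
have [oK cK KE] := confocal_oval R E K conf.
have b0 := smin_gt0 E; have a0 := smaj_gt0 E.
have [oC bC] : ecenter E = center C /\ smin E = radius C.
  apply: ccurve_inj => //; rewrite -EC (ccurve_oval _ (axis E)) ?axis_unit//.
  by rewrite major_scaling_oval divfK ?gt_eqF.
(* A single Poncelet triangle gives the closing condition for the semi-axes of the scaled
   caustic. *)
move: CD_poncelet => [P1 [P2 [P3 pon]]].
have [] := sum_eq (axis E) (smin E / smaj E * smaj K) (smin K) (axis_unit E) _
  (smin_gt0 K) _ _ _ _ pon.
- by rewrite !mulr_gt0 ?invr_gt0.
- by rewrite -KD KE major_scaling_oval oC.
rewrite -bC => sumb areaE.
have [h [hP alE beE]] := caustic_h_param _ _ _ _ _ b0 (smin_le_smaj E) (smaj_gt0 K)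
  (smin_gt0 K) cK sumb.
exists h; split; first exact: h_param_unique.
(* The area sum of one triangle is computed in two frames; comparing them avoids matching the
   semi-axes of D with those of the scaled caustic. *)
move: (sumD _ _ _ pon) => [_]; rewrite areaE -bC => -[<-].
by rewrite alE beE; field.
Qed.
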